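(* Let $p$ be a prime number and let $A$ be a commutative integral domain with unit, of characteristic $0$, equipped with the $p$-adic topology (the topology induced by the filtration $A\supset pA\supset p^2A\supset\cdots$), and suppose that $A$ is complete for this topology. Let $\tilde A=A/pA$. Then the following conditions are equivalent: 1. for all $x\in A$, $\sigma(x)=x^p\equiv x \pmod{pA}$; 2. for all $\bar x\in\tilde A$, $\sigma(\bar x)=\bar x^p=\bar x$; 3. every $x\in A$ can be written as a $p$-adically convergent series $x=\sum_{i=0}^{\infty}x_ip^i$ with $x_i\in A$ and $\sigma(x_i)=x_i$ for all $i\ge 0$.
   Context: $\sigma$ denotes the Frobenius ($p$-th power) map $x\mapsto x^p$, on $A$ and on $\tilde A$. ''Complete'' means Hausdorff and complete for the $p$-adic topology, i.e. the natural map $A\to\varprojlim_n A/p^nA$ is an isomorphism. *)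

(* Defs.v *)
From HB Require Import structures.
From mathcomp Require Import all_boot all_algebra.
From mathcomp Require Import all_classical.
From mathcomp Require Import topology_structure.

Set Implicit Arguments.
Unset Strict Implicit.
Unset Printing Implicit Defensive.

Import GRing.Theory.
Local Open Scope ring_scope.
Local Open Scope quotient_scope.
Local Open Scope classical_set_scope.

Section PrincipalIdeal.
Variables (A : comNzRingType) (a : A).

Definition pideal : A -> bool := fun x => `[< exists y, x = a * y >].

Lemma pidealP x : reflect (exists y, x = a * y) (x \in pideal).
Proof. exact: asboolP. Qed.

Lemma pideal_zmod_closed : zmod_closed pideal.
Proof.
split=> [|x y /pidealP[u ->] /pidealP[v ->]]; apply/pidealP.
  by exists 0; rewrite mulr0.
by exists (u - v); rewrite mulrBr.
Qed.

HB.instance Definition _ := GRing.isZmodClosed.Build A pideal pideal_zmod_closed.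

Definition pideal_zmod : zmodClosed A := GRing.ZmodClosed.clone A pideal _.

Lemma pidealMl x y : x \in pideal -> y * x \in pideal.
Proof. by move=> /pidealP[u ->]; apply/pidealP; exists (y * u); rewrite mulrCA. Qed.

End PrincipalIdeal.

(* A / aA. The library only makes {ideal_quot I} a ring when I is a proper ideal;
   as aA is not assumed proper here, the quotient is made a possibly zero
   commutative ring (comPzRingType). *)
Section QuotientRing.
Variables (A : comNzRingType) (a : A).

Definition quotR := {ideal_quot (pideal_zmod a)}.

HB.instance Definition _ := GRing.Zmodule.on quotR.
HB.instance Definition _ : EqQuotient A (Quotient.equiv (pideal_zmod a)) quotR :=
  EqQuotient.on quotR.

Definition quotR_pi (x : A) : quotR := \pi_quotR x.

Lemma quotR_piP x y : (quotR_pi x = quotR_pi y) <-> (x - y \in pideal a).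
Proof.
rewrite (Quotient.idealrBE (pideal_zmod a)).
by split=> [/eqP|/eqP].
Qed.

Definition quotR_one : quotR := quotR_pi 1.
Definition quotR_mul (x y : quotR) : quotR := quotR_pi (repr x * repr y).

Lemma quotR_piK (x : quotR) : quotR_pi (repr x) = x.
Proof. exact: reprK. Qed.

Lemma quotR_ind (P : quotR -> Prop) : (forall x, P (quotR_pi x)) -> forall q, P q.
Proof. by move=> Px q; rewrite -(quotR_piK q). Qed.

Lemma quotR_piM x y : quotR_pi (x * y) = quotR_mul (quotR_pi x) (quotR_pi y).
Proof.
apply/quotR_piP.
set u := repr _; set v := repr _.
have xu : x - u \in pideal a by apply/quotR_piP; rewrite quotR_piK.
have yv : y - v \in pideal a by apply/quotR_piP; rewrite quotR_piK.
have -> : x * y - u * v = y * (x - u) + u * (y - v).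
  by rewrite !mulrBr (mulrC y x) (mulrC y u) addrA subrK.
by rewrite rpredD // pidealMl.
Qed.

Lemma quotR_piD x y : quotR_pi (x + y) = quotR_pi x + quotR_pi y.
Proof. by rewrite /quotR_pi -[LHS]/(\pi_{ideal_quot (pideal_zmod a)} (x + y)) raddfD. Qed.

Lemma quotR_mulA : associative quotR_mul.
Proof.
elim/quotR_ind=> x; elim/quotR_ind=> y; elim/quotR_ind=> z.
by rewrite -!quotR_piM mulrA.
Qed.

Lemma quotR_mulC : commutative quotR_mul.
Proof.
by elim/quotR_ind=> x; elim/quotR_ind=> y; rewrite -!quotR_piM mulrC.
Qed.

Lemma quotR_mul1 : left_id quotR_one quotR_mul.
Proof. by elim/quotR_ind=> x; rewrite -quotR_piM mul1r. Qed.

Lemma quotR_mulDl : left_distributive quotR_mul +%R.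
Proof.
elim/quotR_ind=> x; elim/quotR_ind=> y; elim/quotR_ind=> z.
by rewrite -!quotR_piM -!quotR_piD -quotR_piM mulrDl.
Qed.

HB.instance Definition _ := GRing.Zmodule_isComPzRing.Build quotR
  quotR_mulA quotR_mulC quotR_mul1 quotR_mulDl.

Lemma quotR_pi_zmod_morphism : zmod_morphism quotR_pi.
Proof.
by move=> x y; rewrite /quotR_pi -[LHS]/(\pi_{ideal_quot (pideal_zmod a)} (x - y)) raddfB.
Qed.
Lemma quotR_pi_monoid_morphism : monoid_morphism quotR_pi.
Proof. by split=> [|x y]; [|exact: quotR_piM]. Qed.

HB.instance Definition _ :=
  GRing.isZmodMorphism.Build A quotR quotR_pi quotR_pi_zmod_morphism.
HB.instance Definition _ :=
  GRing.isMonoidMorphism.Build A quotR quotR_pi quotR_pi_monoid_morphism.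

End QuotientRing.

Section InverseLimit.
Variables (p : nat) (A : comNzRingType).

Definition quot_pn (n : nat) := quotR ((p%:R : A) ^+ n).

Definition quot_pn_proj (n : nat) (q : quot_pn n.+1) : quot_pn n :=
  quotR_pi _ (repr q).

Lemma quot_pn_proj_pi n (x : A) :
  quot_pn_proj (quotR_pi _ x : quot_pn n.+1) = quotR_pi _ x.
Proof.
apply/quotR_piP.
have /quotR_piP/pidealP[y ->] := quotR_piK (quotR_pi _ x : quot_pn n.+1).
by apply/pidealP; exists (p%:R * y); rewrite mulrA -exprSr.
Qed.

Definition coherent (f : forall n, quot_pn n) : Prop :=
  forall n, quot_pn_proj (f n.+1) = f n.

Definition quot_pn_lim : Type := {f : forall n, quot_pn n | coherent f}.

Definition to_quot_pn_lim (x : A) : quot_pn_lim :=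
  exist coherent (fun n => quotR_pi _ x) (fun n => quot_pn_proj_pi n x).

(* The operations of the inverse limit are componentwise, so the natural map is
   a ring morphism and it is an isomorphism iff it is bijective. *)
Definition padically_complete : Prop := bijective to_quot_pn_lim.

End InverseLimit.

(* Copy of A carrying the p-adic topology. *)
Definition padic (p : nat) (A : comNzRingType) : Type := A.

Section PadicTopology.
Variables (p : nat) (A : comNzRingType).
Local Notation T := (padic p A).

HB.instance Definition _ := GRing.ComNzRing.copy T A.

Definition padic_ball (x : T) (n : nat) : set T :=
  [set y | (y - x : A) \in pideal ((p%:R : A) ^+ n)].

Definition padic_nbhs (x : T) : set_system T := filter_from setT (padic_ball x).

HB.instance Definition _ := hasNbhs.Build T padic_nbhs.

Lemma padic_ball_refl x n : padic_ball x n x.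
Proof. by rewrite /padic_ball /= subrr; exact: rpred0. Qed.

Lemma padic_ball_le x m n : (m <= n)%N -> padic_ball x n `<=` padic_ball x m.
Proof.
move=> mn y /pidealP[z yxE]; apply/pidealP.
by exists (p%:R ^+ (n - m) * z); rewrite mulrA -exprD subnKC.
Qed.

Lemma padic_nbhs_filter (x : T) : ProperFilter (nbhs x).
Proof.
apply: filter_from_proper; last by move=> n _; exists x; exact: padic_ball_refl.
apply: filter_from_filter; first by exists 0%N.
move=> m n _ _; exists (maxn m n) => //.
by rewrite subsetI; split; apply: padic_ball_le; rewrite ?leq_maxl ?leq_maxr.
Qed.

Lemma padic_nbhs_singleton (x : T) (B : set T) : nbhs x B -> B x.
Proof. by move=> [n _ nB]; apply: nB; exact: padic_ball_refl. Qed.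

Lemma padic_nbhs_nbhs (x : T) (B : set T) : nbhs x B -> nbhs x (nbhs^~ B).
Proof.
move=> [n _ nB]; exists n => // y xy; exists n => // z yz; apply: nB.
by rewrite /padic_ball /= -(subrKA y) rpredD.
Qed.

HB.instance Definition _ := Nbhs_isNbhsTopological.Build T
  padic_nbhs_filter padic_nbhs_singleton padic_nbhs_nbhs.

End PadicTopology.

(* Main.v *)
(* The Teichmueller idea: if x^p = x mod p, then raising to the p-th power
   improves congruences modulo p^(n+1) to congruences modulo p^(n+2), so that
   x^(p^n) is a Cauchy sequence; its limit t is fixed by the p-th power map and
   congruent to x modulo p. Writing x = t + p x' and iterating on x' gives the
   series expansion. Conversely, x is congruent modulo p to the first term of
   its expansion, which is fixed by the p-th power map. *)
Require Import Defs.
From mathcomp Require Import all_boot all_algebra.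
From mathcomp Require Import all_classical.
From mathcomp Require Import topology_structure sequences.

Set Implicit Arguments.
Unset Strict Implicit.
Unset Printing Implicit Defensive.

Import GRing.Theory.
Local Open Scope ring_scope.
Local Open Scope classical_set_scope.

Lemma pidealX_le (A : comNzRingType) (a x : A) (m n : nat) :
  (m <= n)%N -> x \in pideal (a ^+ n) -> x \in pideal (a ^+ m).
Proof.
move=> mn /pidealP[z ->]; apply/pidealP.
by exists (a ^+ (n - m) * z); rewrite mulrA -exprD subnKC.
Qed.

Lemma pideal_subX (A : comNzRingType) (a x y : A) (k : nat) :
  x - y \in pideal a -> x ^+ k - y ^+ k \in pideal a.
Proof. by rewrite subrXX mulrC; exact: pidealMl. Qed.

(* The cofactor of x - y in x^p - y^p is congruent to p y^(p-1) modulo p. *)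
Lemma pideal_sub_frobenius (p : nat) (A : comNzRingType) (x y : A) (n : nat) :
  x - y \in pideal ((p%:R : A) ^+ n.+1) ->
  x ^+ p - y ^+ p \in pideal ((p%:R : A) ^+ n.+2).
Proof.
move=> xy; have /quotR_piP xyE : x - y \in pideal (p%:R : A).
  by rewrite -(expr1 (p%:R : A)); exact: pidealX_le xy.
rewrite subrXX; set s := \sum_(i < p) _.
(* Written as a difference, the membership becomes an equation in A/pA by [quotR_piP]; there x and y
   agree, so [s] is p equal terms. *)
have : s - 0 \in pideal (p%:R : A).
  have p0 : p%:R = 0 :> quotR (p%:R : A).
    rewrite -(rmorph_nat (quotR_pi (p%:R : A))) -(rmorph0 (quotR_pi (p%:R : A))).
    apply/quotR_piP/pidealP.
    by exists 1; rewrite subr0 mulr1.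
  apply/quotR_piP; rewrite rmorph_sum rmorph0.
  rewrite (eq_bigr (fun=> quotR_pi (p%:R : A) y ^+ p.-1)) => [|i _].
    by rewrite sumr_const card_ord -[LHS]mulr_natr p0 mulr0.
  rewrite rmorphM !rmorphXn /= xyE -exprD; congr (_ ^+ _).
  by case: (p) i => [[]//|q] i; rewrite subnK // -ltnS.
rewrite subr0 => /pidealP[v ->]; have /pidealP[w ->] := xy.
by apply/pidealP; exists (w * v); rewrite mulrACA -exprSr.
Qed.

Section Complete.
Variables (p : nat) (A : comNzRingType).
Hypothesis A_complete : padically_complete p A.

(** This is the injectivity of [to_quot_pn_lim]. *)
Lemma padic_separated (x y : A) :
  (forall n, x - y \in pideal ((p%:R : A) ^+ n)) -> x = y.
Proof.
move=> xy; apply: (bij_inj A_complete); apply: eq_exist.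
by apply: functional_extensionality_dep => n; apply/quotR_piP.
Qed.

(** The classes of [u n] modulo p^n form a coherent family; surjectivity of [to_quot_pn_lim] lifts
    it to t. *)
Lemma padic_cauchy (u : nat -> A) :
  (forall n, u n.+1 - u n \in pideal ((p%:R : A) ^+ n)) ->
  exists t, forall n, t - u n \in pideal ((p%:R : A) ^+ n).
Proof.
move=> uP; have uC : coherent (fun n => quotR_pi _ (u n) : quot_pn p A n).
  by move=> n; rewrite quot_pn_proj_pi; apply/quotR_piP.
have [g _ gK] := A_complete; exists (g (exist _ _ uC)) => n.
by apply/quotR_piP; have /(congr1 (fun f => sval f n)) := gK (exist _ _ uC).
Qed.

Lemma teichmuller (x : A) : x ^+ p - x \in pideal (p%:R : A) ->
  exists2 t, t ^+ p = t & t - x \in pideal (p%:R : A).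
Proof.
move=> xp; pose u n := x ^+ (p ^ n).
have uS n : u n.+1 = u n ^+ p by rewrite /u expnSr exprM.
have uP n : u n.+1 - u n \in pideal ((p%:R : A) ^+ n.+1).
  elim: n => [|n IHn]; first by rewrite uS /u expn0 !expr1.
  by rewrite uS {2}(uS n); exact: pideal_sub_frobenius.
have [n|t tu] := @padic_cauchy u; first exact: pidealX_le (uP n).
exists t.
  (* Since [u n.+1] is the p-th power of [u n], both t^p and t are congruent to it modulo p^n. *)
  apply: padic_separated => n; rewrite -(subrKA (u n.+1)) rpredD //.
    by rewrite uS; exact: pideal_subX.
  by rewrite -opprB rpredN; exact: pidealX_le (tu n.+1).
(* Compare through [u 1], which is x^p: [tu 0] is only a congruence modulo 1. *)
by rewrite -(subrKA (u 1)) rpredD //; exact: tu 1.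
Qed.

Lemma teichmuller_expansion (x : A) :
  (forall y : A, y ^+ p - y \in pideal (p%:R : A)) ->
  exists2 x_ : nat -> A, (forall i, x_ i ^+ p = x_ i) &
    forall n, \sum_(0 <= i < n) x_ i * p%:R ^+ i - x
      \in pideal ((p%:R : A) ^+ n).
Proof.
move=> Ap.
have /choice[f fP] y : exists tz : A * A,
    tz.1 ^+ p = tz.1 /\ y = tz.1 + p%:R * tz.2.
  have [t tp ty] := teichmuller (Ap y).
  have /pidealP[z tyE] := ty; exists (t, - z); split => //=.
  by rewrite mulrN -tyE subKr.
(* [r n] is the remainder after n digits, and the next digit is the fixed point chosen for it. *)
pose r n := iter n (fun y => (f y).2) x.
exists (fun n => (f (r n)).1) => [n|n]; first by have [] := fP (r n).
suff xE : x = \sum_(0 <= i < n) (f (r i)).1 * p%:R ^+ i + p%:R ^+ n * r n.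
  by rewrite [X in _ - X]xE opprD addNKr rpredN; apply/pidealP; exists (r n).
elim: n => [|n IHn]; first by rewrite big_nil add0r mul1r.
rewrite big_nat_recr //= {1}IHn -addrA; congr (_ + _).
have [_ {1}->] := fP (r n).
by rewrite mulrDr mulrC mulrA -exprSr.
Qed.

End Complete.

(** The balls [padic_ball x n] form a neighbourhood basis at x. *)
Lemma cvg_padicP (p : nat) (A : comNzRingType) (u : nat -> padic p A)
    (x : padic p A) :
  u @ \oo --> x <-> forall n, \forall k \near \oo,
    (u k - x : A) \in pideal ((p%:R : A) ^+ n).
Proof.
split=> [ux n|ux B [n _ nB]]; first by apply: (ux (padic_ball x n)); exists n.
by apply: filterS (ux n) => k; exact: nB.
Qed.

Theorem theorem1p2 (p : nat) (A : idomainType)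
  (p_prime : prime p) (A_char0 : [pchar A] =i pred0)
  (A_complete : padically_complete p A) :
  [<-> (forall x : A, x ^+ p - x \in pideal (p%:R : A));
       (forall xbar : quotR (p%:R : A), xbar ^+ p = xbar);
       (forall x : A, exists x_ : nat -> A,
          (forall i, x_ i ^+ p = x_ i) /\
          series (fun i => x_ i * p%:R ^+ i : padic p A) @ \oo
            --> (x : padic p A))].
Proof.
tfae.
- by move=> Ap; elim/quotR_ind => x; rewrite -rmorphXn; apply/quotR_piP.
- move=> Ap x.
  have [y|x_ x_p x_E] := teichmuller_expansion A_complete x.
    by apply/quotR_piP; rewrite rmorphXn; exact: Ap.
  exists x_; split=> //; apply/cvg_padicP => n.
  by exists n => // k /= nk; exact: pidealX_le (x_E k).
- move=> Ex x; have [x_ [x_p /cvg_padicP/(_ 1)[N _ xN]]] := Ex x.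
  (* The index [N.+1] rather than [N] makes the partial sum nonempty, so that [x_ 0] can be split
     off; all later terms are divisible by p. *)
  have := xN N.+1 (leqnSn N); rewrite expr1 => /quotR_piP.
  have -> : quotR_pi (p%:R : A) (series (fun i => x_ i * p%:R ^+ i) N.+1)
      = quotR_pi _ (x_ 0).
    apply/quotR_piP; rewrite /series /= big_nat_recl // expr0 mulr1 addrAC subrr.
    rewrite add0r rpred_sum // => i _; apply/pidealP.
    by exists (x_ i.+1 * p%:R ^+ i); rewrite exprS mulrCA.
  by move=> xE; apply/quotR_piP; rewrite rmorphXn /= -xE -rmorphXn x_p.
Qed.
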